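(* The following inequalities hold. (i) For all integers $n\ge 1$ and all $x\in[0,+\infty)$, $$2U_{n}(x)\leq U_{n-1}(x)+U_{n+1}(x),$$ $$U_{n+1}(x)\leq \frac{1+4nx+x^{2}}{1+(4n+4)x+x^{2}}\,U_{n-1}(x),$$ $$U_{n}(x)\leq \frac{1+(4n+2)x+x^{2}}{1+(4n+4)x+x^{2}}\,U_{n-1}(x).$$ (ii) For all integers $n\ge 2$ and all $x\in[0,+\infty)$, $$2G_{n}(x)\leq G_{n-1}(x)+G_{n+1}(x),$$ $$G_{n+1}(x)\leq \frac{1+(4n-2)x(1+x)}{1+(4n+2)x(1+x)}\,G_{n-1}(x),$$ $$G_{n}(x)\leq \frac{1+4nx(x+1)}{1+(4n+2)x(x+1)}\,G_{n-1}(x).$$ (iii) For all integers $n\ge 1$ and all $x\in[0,1)$, $$2J_{n}(x)\leq J_{n-1}(x)+J_{n+1}(x),$$ $$J_{n+1}(x)\leq \frac{1+4nx+x^{2}}{1+(4n+4)x+x^{2}}\,J_{n-1}(x),$$ $$J_{n}(x)\leq \frac{1+(4n+2)x+x^{2}}{1+(4n+4)x+x^{2}}\,J_{n-1}(x).$$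
   Context: The functions are defined as follows (with the convention $0^0=1$): $$U_n(x)=\sum_{k=0}^{n}\left(\binom{n}{k}x^{k}(1+x)^{-n}\right)^{2},\quad x\in[0,+\infty),\ n=0,1,2,\dots$$ $$G_n(x)=\sum_{k=0}^{\infty}\left(\binom{n+k-1}{k}x^{k}(1+x)^{-n-k}\right)^{2},\quad x\in[0,+\infty),\ n=1,2,\dots$$ $$J_n(x)=\sum_{k=0}^{\infty}\left(\binom{n+k}{k}x^{k}(1-x)^{n+1}\right)^{2},\quad x\in[0,1),\ n=0,1,2,\dots$$ *)

(* Defs.v *)
From mathcomp Require Import all_boot all_order all_algebra.
From mathcomp Require Import all_classical all_reals all_analysis.
Set Implicit Arguments.
Unset Strict Implicit.
Unset Printing Implicit Defensive.
Import Order.TTheory GRing.Theory Num.Theory.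
Import numFieldNormedType.Exports.
Local Open Scope ring_scope.

Definition U (R : realType) (n : nat) (x : R) : R :=
  \sum_(0 <= k < n.+1) ('C(n, k)%:R * x ^+ k * (1 + x) ^- n) ^+ 2.

(* Meaningful for n >= 1 and 0 <= x, where the series converges; the
   subtraction in n + k - 1 is then never truncated. *)
Definition G (R : realType) (n : nat) (x : R) : R :=
  limn (series (fun k : nat =>
    ('C((n + k - 1)%N, k)%:R * x ^+ k * (1 + x) ^- (n + k)%N) ^+ 2)).

(* Meaningful for 0 <= x < 1, where the series converges. *)
Definition J (R : realType) (n : nat) (x : R) : R :=
  limn (series (fun k : nat =>
    ('C((n + k)%N, k)%:R * x ^+ k * (1 - x) ^+ n.+1) ^+ 2)).

(* Main.v *)
Require Import Defs.
From mathcomp Require Import all_boot all_order all_algebra.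
From mathcomp Require Import all_classical all_reals all_analysis.
From mathcomp Require Import ring lra.
Import Order.TTheory GRing.Theory Num.Theory.
Import numFieldNormedType.Exports.
Local Open Scope ring_scope.
Set Implicit Arguments.
Unset Strict Implicit.
Unset Printing Implicit Defensive.

Local Open Scope classical_set_scope.

(** Write f = (1 + x X) / (1 + x).  The coefficients of f ^ n are the numbers
    squared in [U n x], so by Parseval [U n x] is the mean over the unit circle
    of w ^ n, where w = |f| ^ 2 >= 0.  Hence the second difference of
    [n |-> U n x] is the mean of w ^ n (1 - w) ^ 2, which is nonnegative.  The
    square can be exhibited without any integral: it is the squared l2 norm of
    a polynomial ([pdot_convex]).

    Up to normalisation [U n x] is also a Legendre polynomial, and as such it
    satisfies the three-term recurrence
      (n+1) (1+x)^2 U_(n+1) = (2n+1) (1+x^2) U_n - n (1-x)^2 U_(n-1)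
    ([U_recurrence], a coefficientwise identity between binomials).  The
    recurrence expresses each of U_n and U_(n+1) through the other and U_(n-1);
    eliminating one of them from the convexity inequality gives exactly the two
    ratio bounds ([ratio_bounds]).

    The two other families reduce to the first.  The power series of [J]
    satisfies the same recurrence ([J_recurrence]), and comparing the values at
    n = 0 yields J_n(x) = (1-x)/(1+x) U_n(x) on [0,1[ ([J_U]); the three
    inequalities are homogeneous, so they pass from [U] to [J].  Finally
    G_(n+1)(x) = J_n(x/(1+x)) term by term ([G_J]), and the substitution
    x |-> x/(1+x) turns the rational factors for [J] into those for [G]. *)

(** * The l2 inner product on polynomials and convexity *)

Definition pdot (R : nzRingType) (p q : {poly R}) : R :=
  \sum_(i < size p) p`_i * q`_i.

(** The sum may run over any long enough range, which is what makes the
    inner product symmetric and additive on the left. *)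
Lemma pdot_widen (R : nzRingType) (p q : {poly R}) (N : nat) :
  (size p <= N)%N -> pdot p q = \sum_(i < N) p`_i * q`_i.
Proof.
move=> leN; rewrite /pdot (big_ord_widen N (fun i => p`_i * q`_i) leN).
rewrite big_mkcond /=; apply: eq_bigr => i _.
by case: ltnP => // le_pi; rewrite nth_default ?mul0r.
Qed.

Lemma pdotC (R : comNzRingType) (p q : {poly R}) : pdot p q = pdot q p.
Proof.
rewrite (@pdot_widen _ p q (maxn (size p) (size q))) ?leq_maxl//.
rewrite (@pdot_widen _ q p (maxn (size p) (size q))) ?leq_maxr//.
by apply: eq_bigr => i _; rewrite mulrC.
Qed.

Lemma pdotDr (R : comNzRingType) (p q1 q2 : {poly R}) :
  pdot p (q1 + q2) = pdot p q1 + pdot p q2.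
Proof.
by rewrite /pdot -big_split; apply: eq_bigr => i _; rewrite coefD mulrDr.
Qed.

Lemma pdotZr (R : comNzRingType) (a : R) (p q : {poly R}) :
  pdot p (a *: q) = a * pdot p q.
Proof.
by rewrite /pdot mulr_sumr; apply: eq_bigr => i _; rewrite coefZ mulrCA.
Qed.

Lemma pdotDl (R : comNzRingType) (p1 p2 q : {poly R}) :
  pdot (p1 + p2) q = pdot p1 q + pdot p2 q.
Proof. by rewrite ![pdot _ q]pdotC pdotDr. Qed.

Lemma pdotZl (R : comNzRingType) (a : R) (p q : {poly R}) :
  pdot (a *: p) q = a * pdot p q.
Proof. by rewrite ![pdot _ q]pdotC pdotZr. Qed.

Lemma pdot_mulX (R : comNzRingType) (p q : {poly R}) :
  pdot (p * 'X) (q * 'X) = pdot p q.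
Proof.
rewrite (@pdot_widen _ _ _ (size p).+1); last first.
  by rewrite (leq_trans (size_polyMleq _ _)) // size_polyX addn2.
rewrite big_ord_recl !coefMX mul0r add0r.
by apply: eq_bigr => i _; rewrite !coefMX.
Qed.

Lemma pdot_ge0 (R : realDomainType) (p : {poly R}) : 0 <= pdot p p.
Proof. by apply: sumr_ge0 => i _; rewrite -expr2 sqr_ge0. Qed.

(** On the unit circle the conjugate of f = a + b X is e / X with e = b + a X.
    So multiplication by |f|^2 sends p to e f p / X, and the difference of the
    two sides is the squared norm of (1 - |f|^2) p, that is, of p X - e f p.
    Its expansion rests on two facts: multiplication by X is an isometry, and
    multiplications by f and by e / X are adjoint to each other. *)
Lemma pdot_convex (R : realDomainType) (a b : R) (p : {poly R})
    (f := a%:P + b *: 'X) :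
  2 * pdot (f * p) (f * p) <= pdot p p + pdot (f * (f * p)) (f * (f * p)).
Proof.
pose h := f * p.
have fE q : f * q = a *: q + b *: (q * 'X).
  by rewrite /f mulrDl mul_polyC -scalerAl [_ * q]mulrC.
(* The polynomial e f p, with e = b + a X as above. *)
pose g := a *: (h * 'X) + b *: h.
have ghh : pdot g g = pdot (f * h) (f * h).
  rewrite fE /g !(pdotDl, pdotDr, pdotZl, pdotZr) pdot_mulX.
  rewrite (pdotC (h * 'X)); ring.
have gph : pdot (p * 'X) g = pdot h h.
  rewrite /g pdotDr !pdotZr pdot_mulX {3}/h fE pdotDl !pdotZl.
  by rewrite -/h.
(* An opaque g keeps the bilinear expansion from going inside it. *)
clearbody g; have := pdot_ge0 (p * 'X + (-1) *: g).
rewrite !(pdotDl, pdotDr, pdotZl, pdotZr) pdot_mulX ghh (pdotC g) gph -/h.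
lra.
Qed.

Lemma coef_exp_linear (R : comNzRingType) (a b : R) (n k : nat) :
  (k <= n)%N ->
  ((a%:P + b *: 'X) ^+ n)`_k = 'C(n, k)%:R * a ^+ (n - k) * b ^+ k.
Proof.
have coef_term (i : nat) : (a%:P ^+ (n - i) * (b *: 'X) ^+ i *+ 'C(n, i))`_k =
    'C(n, i)%:R * a ^+ (n - i) * b ^+ i * (k == i)%:R.
  rewrite coefMn -polyC_exp exprZn coefCM coefZ coefXn -[in LHS]mulr_natl.
  ring.
move=> lekn; rewrite exprDn coef_sum (bigD1 (inord k)) //= big1 => [|i].
  by rewrite coef_term inordK ?ltnS// eqxx mulr1 addr0.
rewrite -val_eqE /= inordK ?ltnS// coef_term eq_sym => /negbTE->.
by rewrite mulr0.
Qed.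

(** Parseval's identity: [U n x] is the squared norm of f ^ n. *)
Lemma U_pdot (R : realType) (n : nat) (x : R)
    (f := ((1 + x)^-1)%:P + (x / (1 + x)) *: 'X) :
  0 <= x -> U n x = pdot (f ^+ n) (f ^+ n).
Proof.
move=> x0; have x1 : 1 + x != 0 by apply: lt0r_neq0; lra.
rewrite (@pdot_widen _ _ _ n.+1); last first.
  rewrite (leq_trans (size_poly_exp_leq _ _)) // ltnS.
  have : ((size f).-1 <= 1)%N.
    rewrite -subn1 leq_subLR (leq_trans (size_polyD _ _)) // geq_max.
    rewrite (leq_trans (size_polyC_leq1 _)) //.
    by rewrite (leq_trans (size_scale_leq _ _)) // size_polyX.
  by move/(leq_mul (leqnn n)); rewrite muln1 mulnC.
rewrite /U big_mkord; apply: eq_bigr => i _.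
rewrite -expr2 coef_exp_linear -1?ltnS//; congr (_ ^+ 2).
have leni : (i <= n)%N by rewrite -ltnS.
rewrite expr_div_n exprVn -!mulrA; congr (_ * _).
have <- : (1 + x) ^+ (n - i) * (1 + x) ^+ i = (1 + x) ^+ n.
  by rewrite -exprD subnK.
by rewrite invfM mulrCA.
Qed.

Lemma U_convex (R : realType) (n : nat) (x : R) : 0 <= x ->
  2 * U n.+1 x <= U n x + U n.+2 x.
Proof. by move=> x0; rewrite !U_pdot// !exprS; apply: pdot_convex. Qed.

(** * The three-term recurrence and the ratio bounds *)

(** As a polynomial in y this is (1 - y)^n P_n((1 + y) / (1 - y)), with P_n the
    Legendre polynomial. *)
Definition binsq_poly (R : nzRingType) (n : nat) : {poly R} :=
  \poly_(k < n.+1) ('C(n, k)%:R ^+ 2).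

Lemma coef_binsq_poly (R : nzRingType) (n k : nat) :
  (binsq_poly R n)`_k = 'C(n, k)%:R ^+ 2.
Proof.
by rewrite coef_poly; case: ltnP => // ltnk; rewrite bin_small// expr0n.
Qed.

(** With a subtraction in the ring, the identity also holds beyond the
    diagonal, where both binomials vanish. *)
Lemma natr_bin_left (R : nzRingType) (m j : nat) :
  j.+1%:R * 'C(m, j.+1)%:R = (m%:R - j%:R) * 'C(m, j)%:R :> R.
Proof.
case: (leqP j m) => [lejm | ltmj].
  by rewrite -natrB// -!natrM mul_bin_left.
by rewrite !bin_small ?mulr0// ltnW.
Qed.

(** Pascal's rule writes every binomial in terms of three consecutive entries
    of row m, and these are proportional by [natr_bin_left]; what remains is a
    rational identity in m and k. *)
Lemma bin_sq_recurrence (R : numFieldType) (m k : nat)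
    (C := fun a b : nat => 'C(a, b)%:R : R) :
  m.+2%:R * C m.+2 k.+2 ^+ 2 =
    (2 * m.+1%:R + 1) * (C m.+1 k.+2 ^+ 2 + C m.+1 k.+1 ^+ 2)
    - m.+1%:R * (C m k.+2 ^+ 2 - 2 * C m k.+1 ^+ 2 + C m k ^+ 2).
Proof.
rewrite /C !binS !natrD.
have := natr_bin_left R m k.+1; have := natr_bin_left R m k.
set a := 'C(m, k.+2)%:R; set b := 'C(m, k.+1)%:R; set c := 'C(m, k)%:R.
rewrite -![_.+1%:R]natr1 => hb ha.
have k0 : k%:R + 1 + 1 != 0 :> R by rewrite !natr1 pnatr_eq0.
have {ha} -> : a = (m%:R - (k%:R + 1)) * b / (k%:R + 1 + 1).
  by apply: (mulfI k0); rewrite ha; field.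
have k1 : k%:R + 1 != 0 :> R by rewrite !natr1 pnatr_eq0.
have {hb} -> : b = (m%:R - k%:R) * c / (k%:R + 1).
  by apply: (mulfI k1); rewrite hb; field.
by field; apply/andP.
Qed.

(** Bonnet's recurrence for the Legendre polynomials.  At n = 0 its last term
    carries the factor 0, so the recurrence gives the polynomial of index 1 in
    terms of the one of index 0. *)
Lemma binsq_poly_recurrence (R : numFieldType) (n : nat) :
  n.+1%:R *: binsq_poly R n.+1 =
    (2 * n%:R + 1) *: ((1 + 'X) * binsq_poly R n)
    - n%:R *: ((1 - 'X) ^+ 2 * binsq_poly R n.-1).
Proof.
have XE (q : {poly R}) : (1 - 'X) ^+ 2 * q = q - 2 *: (q * 'X) + q * 'X * 'X.
  by rewrite -mul_polyC polyCMn; ring.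
have XE1 (q : {poly R}) : (1 + 'X) * q = q + q * 'X by ring.
rewrite XE XE1; apply/polyP => k.
rewrite !(coefB, coefD, coefZ, coefMX, coef_binsq_poly).
case: n => [|m].
  have bin0E i : 'C(0, i) = (i == 0)%N by case: i.
  have bin1E i : 'C(1, i) = (i <= 1)%N by case: i => [|[|i]].
  rewrite !bin0E bin1E; case: k => [|[|k]] /=; rewrite ?bin0E /=; ring.
(* The coefficients of degree 0 and 1 do not see all the shifts by X. *)
case: k => [|[|k]] /=.
- rewrite !bin0 -!natr1; ring.
- rewrite !bin1 !bin0 -!natr1; ring.
- exact: bin_sq_recurrence.
Qed.

Lemma U_binsq_poly (R : realType) (n : nat) (x : R) :
  U n x = (binsq_poly R n).[x ^+ 2] / (1 + x) ^+ 2 ^+ n.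
Proof.
rewrite /U horner_poly big_mkord mulr_suml; apply: eq_bigr => i _.
by rewrite 2!exprMn exprVn (exprAC _ i) (exprAC _ n).
Qed.

Lemma U_recurrence (R : realType) (n : nat) (x : R) : 0 <= x ->
  n.+1%:R * (1 + x) ^+ 2 * U n.+1 x =
    (2 * n%:R + 1) * (1 + x ^+ 2) * U n x - n%:R * (1 - x) ^+ 2 * U n.-1 x.
Proof.
move=> x0; have x1 : 1 + x != 0 by apply: lt0r_neq0; lra.
have rec := congr1 (fun p => p.[x ^+ 2]) (binsq_poly_recurrence R n).
rewrite !hornerE /= in rec; rewrite !U_binsq_poly.
have -> (u : R) : n.+1%:R * (1 + x) ^+ 2 * (u / (1 + x) ^+ 2 ^+ n.+1) =
    n.+1%:R * u / (1 + x) ^+ 2 ^+ n.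
  by rewrite [_ ^+ n.+1]exprS; field; rewrite x1 ?expf_neq0.
rewrite {}rec; case: n => [|n] /=; first by rewrite !mul0r !subr0 !expr0; field.
by rewrite [_ ^+ n.+1]exprS; field; rewrite x1 ?expf_neq0.
Qed.

(** The recurrence determines q from p and r, and r from p and q.  Inserting
    2 q <= p + r in it bounds r by p; inserting r >= 2 q - p bounds q by p. *)
Lemma ratio_bounds (R : realFieldType) (n x p q r : R) :
  0 <= n -> 0 <= x -> 2 * q <= p + r ->
  (n + 1) * (1 + x) ^+ 2 * r =
    (2 * n + 1) * (1 + x ^+ 2) * q - n * (1 - x) ^+ 2 * p ->
  r <= (1 + 4 * n * x + x ^+ 2) / (1 + (4 * n + 4) * x + x ^+ 2) * p /\
  q <= (1 + (4 * n + 2) * x + x ^+ 2) / (1 + (4 * n + 4) * x + x ^+ 2) * p.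
Proof.
move=> n0 x0 cvx rec.
have nx0 : 0 <= n * x by rewrite mulr_ge0.
have x20 : 0 <= x ^+ 2 by rewrite sqr_ge0.
have d0 : 0 < 1 + (4 * n + 4) * x + x ^+ 2 by lra.
split; rewrite mulrAC ler_pdivlMr//.
  have := ler_wpM2l (_ : 0 <= (2 * n + 1) * (1 + x ^+ 2)) cvx.
  have -> : 0 <= (2 * n + 1) * (1 + x ^+ 2) by rewrite mulr_ge0; lra.
  by move=> /(_ isT); lra.
have := ler_wpM2l (_ : 0 <= (n + 1) * (1 + x) ^+ 2) cvx.
have -> : 0 <= (n + 1) * (1 + x) ^+ 2 by rewrite mulr_ge0 ?sqr_ge0//; lra.
by move=> /(_ isT); lra.
Qed.

Lemma U_bounds (R : realType) (n : nat) (x : R) : 0 <= x ->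
  [/\ 2 * U n.+1 x <= U n x + U n.+2 x,
      U n.+2 x <=
        (1 + 4 * n.+1%:R * x + x ^+ 2) /
        (1 + (4 * n.+1%:R + 4) * x + x ^+ 2) * U n x
    & U n.+1 x <=
        (1 + (4 * n.+1%:R + 2) * x + x ^+ 2) /
        (1 + (4 * n.+1%:R + 4) * x + x ^+ 2) * U n x].
Proof.
move=> x0; have cvx := U_convex n x0.
have [|r q] := ratio_bounds (ler0n R n.+1) x0 cvx; last by split.
by rewrite natr1 (U_recurrence n.+1).
Qed.

(** * Sums of power series *)

Definition psum (R : realType) (c : nat -> R) (y L : R) : Prop :=
  (series (fun k => c k * y ^+ k)) @ \oo --> L.

(** The coefficients of y * \sum_k c k * y ^ k. *)
Definition coef_shift (R : nmodType) (c : nat -> R) (k : nat) : R :=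
  if k is k'.+1 then c k' else 0.

Lemma psum_unique (R : realType) (c : nat -> R) (y L M : R) :
  psum c y L -> psum c y M -> L = M.
Proof. exact: cvg_unique. Qed.

Lemma psumD (R : realType) (c d : nat -> R) (y L M : R) :
  psum c y L -> psum d y M -> psum (fun k => c k + d k) y (L + M).
Proof.
move=> cL dM; rewrite /psum.
have -> : (fun k => (c k + d k) * y ^+ k) =
    (fun k => c k * y ^+ k) + (fun k => d k * y ^+ k).
  by apply/funext => k; rewrite mulrDl.
by rewrite seriesD; apply: cvgD.
Qed.

Lemma psumZ (R : realType) (c : nat -> R) (a y L : R) :
  psum c y L -> psum (fun k => a * c k) y (a * L).
Proof.
move=> cL; apply: (cvg_trans _ (cvgMl_tmp (a := a) cL)); apply: near_eq_cvg.
apply: nearW => N /=; rewrite /series /= mulr_sumr.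
by apply: eq_bigr => k _; rewrite mulrA.
Qed.

Lemma psum_shift (R : realType) (c : nat -> R) (y L : R) :
  psum c y L -> psum (coef_shift c) y (y * L).
Proof.
move=> cL; rewrite /psum -(cvg_shiftS (series _)).
apply: (cvg_trans _ (cvgMl_tmp (a := y) cL)); apply: near_eq_cvg.
apply: nearW => N /=; rewrite /series /= big_nat_recl//= mul0r add0r mulr_sumr.
by apply: eq_bigr => k _; rewrite exprS mulrCA.
Qed.

(** * The negative binomial series *)

(** The truncated form of (1 - x) (1 - x)^(-n-2) = (1 - x)^(-n-1). *)
Lemma negbin_sum_telescope (R : comNzRingType) (x : R) (n N : nat) :
  (1 - x) * (\sum_(0 <= k < N) 'C(n.+1 + k, k)%:R * x ^+ k)
    + 'C(n + N, n.+1)%:R * x ^+ N = \sum_(0 <= k < N) 'C(n + k, k)%:R * x ^+ k.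
Proof.
elim: N => [|N IHN].
  by rewrite !big_geq// addn0 bin_small// mulr0 mul0r addr0.
rewrite !big_nat_recr//= -IHN addnS.
have -> : 'C(n.+1 + N, N) = 'C((n + N).+1, n.+1).
  by rewrite -(@bin_sub (n.+1 + N)) ?leq_addl// addnK.
have -> : 'C(n + N, N) = 'C(n + N, n).
  by rewrite -(@bin_sub (n + N)) ?leq_addl// addnK.
rewrite binS natrD exprS; ring.
Qed.

(** The terms are negative binomial probabilities. *)
Lemma negbin_sum_le1 (R : realFieldType) (x : R) (n N : nat) : 0 <= x < 1 ->
  \sum_(0 <= k < N) 'C(n + k, k)%:R * x ^+ k * (1 - x) ^+ n.+1 <= 1.
Proof.
case/andP => x0 x1; have y0 : 0 <= 1 - x by lra.
rewrite -mulr_suml; elim: n => [|n IHn].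
  under eq_bigr do rewrite add0n binn mul1r.
  by rewrite expr1 mulrC big_mkord -opprB mulNr -subrX1 opprB gerBl exprn_ge0.
apply: le_trans IHn; rewrite exprS mulrA [_ * (1 - x)]mulrC.
rewrite ler_wpM2r ?exprn_ge0// -(negbin_sum_telescope x n N) lerDl.
by rewrite mulr_ge0 ?exprn_ge0.
Qed.

(** A probability is at least its square, so the partial sums of the squares
    increase and stay below 1. *)
Lemma is_cvg_J (R : realType) (n : nat) (x : R) : 0 <= x < 1 ->
  cvgn (series (fun k : nat =>
    ('C((n + k)%N, k)%:R * x ^+ k * (1 - x) ^+ n.+1) ^+ 2)).
Proof.
move=> x01; have [x0 x1] := andP x01.
pose w k : R := 'C(n + k, k)%:R * x ^+ k * (1 - x) ^+ n.+1.
have w0 k : 0 <= w k by rewrite !mulr_ge0 ?exprn_ge0//; lra.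
have w1 k : w k <= 1.
  have := negbin_sum_le1 n k.+1 x01; rewrite big_nat_recr//=; apply: le_trans.
  by rewrite lerDr; apply: sumr_ge0 => i _; exact: w0.
apply: nondecreasing_is_cvgn.
  by apply: nondecreasing_series => k _ _; rewrite sqr_ge0.
exists 1 => _ [N _ <-]; apply: le_trans (negbin_sum_le1 n N x01).
by apply: ler_sum => k _; rewrite expr2 ler_piMr ?w1 ?w0.
Qed.

Lemma J_psum (R : realType) (n : nat) (x : R) : 0 <= x < 1 ->
  psum (fun k => 'C(n + k, k)%:R ^+ 2) (x ^+ 2) (J n x / (1 - x) ^+ 2 ^+ n.+1).
Proof.
move=> x01; have [x0 x1] := andP x01.
have y0 : 1 - x != 0 by apply: lt0r_neq0; lra.
rewrite /psum; set s := series _.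
have -> : s = fun N => series (fun k =>
    ('C((n + k)%N, k)%:R * x ^+ k * (1 - x) ^+ n.+1) ^+ 2) N
    * ((1 - x) ^+ 2 ^+ n.+1)^-1.
  apply/funext => N; rewrite /s /series /= mulr_suml; apply: eq_bigr => k _.
  by rewrite 2!(exprMn 2) (exprAC _ k) (exprAC _ n.+1) mulfK// !expf_neq0.
by apply: cvgMr_tmp; exact: is_cvg_J.
Qed.

(** Coefficient of y^k in
      (n+1) (1-y)^2 B_(n+1) = (2n+1) (1+y) B_n - n B_(n-1),
    where B_n is the sum of the series of squares of the C(n+k, k).  For k >= 2
    Pascal's rule reduces it to the three consecutive entries a, b, d of the
    diagonal n+1, which are proportional by absorption. *)
Lemma negbin_sq_recurrence (R : numFieldType) (n k : nat)
    (c := fun m k : nat => 'C(m + k, k)%:R ^+ 2 : R) :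
  n.+1%:R * (c n.+1 k + (-2) * coef_shift (c n.+1) k
             + coef_shift (coef_shift (c n.+1)) k) =
    (2 * n%:R + 1) * (c n k + coef_shift (c n) k) + (- n%:R) * c n.-1 k.
Proof.
rewrite /c; case: k => [|[|k]] /=.
- by rewrite !bin0 -natr1; ring.
- rewrite !bin1 !bin0 !addn1; case: n => [|n] /=; rewrite -!natr1; ring.
have hb := mul_bin_diag (n + k.+2) k.
have ha := mul_bin_diag (n + k.+3) k.+1.
rewrite !addnS /= in ha hb; rewrite !addSn !addnS.
have {}hb := congr1 (fun i => i%:R : R) hb.
have {}ha := congr1 (fun i => i%:R : R) ha.
rewrite !natrM -!natr1 natrD in ha hb.
rewrite -[n.+1%:R]natr1; move: ha hb.
set a := 'C((n + k).+3, k.+2)%:R; set b := 'C((n + k).+2, k.+1)%:R.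
set d := 'C((n + k).+1, k)%:R => ha hb.
have -> : 'C((n + k).+2, k.+2)%:R = a - b.
  by rewrite /a [in RHS]binS natrD addrK.
have -> : 'C((n + k).+1, k.+1)%:R = b - d.
  by rewrite /b [in RHS]binS natrD addrK.
have k0 : k%:R + 1 + 1 != 0 :> R by rewrite !natr1 pnatr_eq0.
have k1 : k%:R + 1 != 0 :> R by rewrite !natr1 pnatr_eq0.
have aE : a = (n%:R + k%:R + 1 + 1 + 1) * b / (k%:R + 1 + 1).
  by apply: (mulfI k0); rewrite -ha; field.
have bE : b = (n%:R + k%:R + 1 + 1) * d / (k%:R + 1).
  by apply: (mulfI k1); rewrite -hb; field.
(* For n > 0, e is the entry of the diagonal n - 1, a second difference; for
   n = 0 it is multiplied by 0, and no Pascal rule is available for it. *)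
have red (e : R) : (n == 0)%N \/ e = a - 2 * b + d ->
    (n%:R + 1) * (a ^+ 2 + -2 * b ^+ 2 + d ^+ 2) =
    (2 * n%:R + 1) * ((a - b) ^+ 2 + (b - d) ^+ 2) + - n%:R * e ^+ 2.
  case=> [/eqP n0 | ->].
    by rewrite aE bE n0; field; apply/andP.
  by rewrite aE bE; field; apply/andP.
apply: red; case: n @a @b @d {ha hb aE bE} => [|n] a b d; [by left | right].
rewrite /= /a /b /d !addSn !binS !natrD; ring.
Qed.

(** With B_n = J_n / (1-x)^(2n+2), the recurrence of the series B_n at y = x^2
    becomes the one of [U], since 1 - x^2 = (1-x) (1+x). *)
Lemma J_recurrence (R : realType) (n : nat) (x : R) : 0 <= x < 1 ->
  n.+1%:R * (1 + x) ^+ 2 * J n.+1 x =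
    (2 * n%:R + 1) * (1 + x ^+ 2) * J n x - n%:R * (1 - x) ^+ 2 * J n.-1 x.
Proof.
move=> x01; have [x0 x1] := andP x01.
have y0 : 1 - x != 0 by apply: lt0r_neq0; lra.
have P m := @J_psum R m x x01.
have L := psumZ (a := n.+1%:R) (psumD
   (psumD (P n.+1) (psumZ (a := -2) (psum_shift (P n.+1))))
   (psum_shift (psum_shift (P n.+1)))).
have M := psumD (psumZ (a := 2 * n%:R + 1) (psumD (P n) (psum_shift (P n))))
   (psumZ (a := - n%:R) (P n.-1)).
have {L M} := psum_unique L (eq_ind_r (fun c => psum c _ _) M
   (funext (negbin_sq_recurrence R n))).
set j1 := J n.+1 x; set j := J n x; set j' := J n.-1 x => E.
apply: (@mulIf _ (((1 - x) ^+ 2 ^+ n.+1)^-1)).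
  by rewrite invr_neq0// !expf_neq0.
transitivity (n.+1%:R * (j1 / (1 - x) ^+ 2 ^+ n.+2 +
  -2 * (x ^+ 2 * (j1 / (1 - x) ^+ 2 ^+ n.+2)) +
  x ^+ 2 * (x ^+ 2 * (j1 / (1 - x) ^+ 2 ^+ n.+2)))).
  by rewrite [_ ^+ n.+2]exprS; field; rewrite y0 !expf_neq0.
rewrite E /j'; case: (n) => [|m] /=; first by rewrite !mulr0n; field.
by rewrite [_ ^+ m.+2]exprS; field; rewrite y0 !expf_neq0.
Qed.

(** Both sides satisfy the same recurrence, which at n = 0 involves only one
    previous value; so they agree as soon as they agree at n = 0, where [J] is
    a geometric series. *)
Lemma J_U (R : realType) (n : nat) (x : R) : 0 <= x < 1 ->
  J n x = (1 - x) / (1 + x) * U n x.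
Proof.
move=> x01; have [x0 x1] := andP x01.
have y0 : 1 - x != 0 by apply: lt0r_neq0; lra.
have z0 : 1 + x != 0 by apply: lt0r_neq0; lra.
have step m : J m x = (1 - x) / (1 + x) * U m x ->
    J m.-1 x = (1 - x) / (1 + x) * U m.-1 x ->
    J m.+1 x = (1 - x) / (1 + x) * U m.+1 x.
  move=> Jm Jm1; apply: (@mulfI _ (m.+1%:R * (1 + x) ^+ 2)).
    by rewrite mulf_neq0 ?pnatr_eq0 ?expf_neq0.
  by rewrite [RHS]mulrCA J_recurrence// U_recurrence// Jm Jm1; ring.
have J0 : J 0 x = (1 - x) / (1 + x) * U 0 x.
  have /psum_unique : psum (fun k => 'C(0 + k, k)%:R ^+ 2) (x ^+ 2)
      (1 * (1 - x ^+ 2)^-1).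
    apply: (cvg_trans _ (cvg_geometric_series (a := 1) (z := x ^+ 2) _)).
      apply: near_eq_cvg; apply: nearW => N.
      by apply: eq_bigr => k _; rewrite add0n binn expr1n.
    by rewrite ger0_norm ?sqr_ge0// exprn_ilt1.
  move=> /(_ _ (@J_psum R 0 x x01)) E.
  apply: (@mulIf _ ((1 - x) ^+ 2 ^+ 1)^-1).
    by rewrite invr_neq0 ?expf_neq0.
  rewrite -E /U big_nat1 bin0 !expr0 invr1 !mulr1 expr1n mulr1.
  have -> : 1 - x ^+ 2 = (1 - x) * (1 + x) by ring.
  by rewrite expr1; field; apply/andP.
suff [] : J n x = (1 - x) / (1 + x) * U n x /\
  J n.+1 x = (1 - x) / (1 + x) * U n.+1 x by [].
elim: n => [|n [IH1 IH2]]; split=> //; exact: step.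
Qed.

Lemma J_bounds (R : realType) (n : nat) (x : R) : 0 <= x < 1 ->
  [/\ 2 * J n.+1 x <= J n x + J n.+2 x,
      J n.+2 x <=
        (1 + 4 * n.+1%:R * x + x ^+ 2) /
        (1 + (4 * n.+1%:R + 4) * x + x ^+ 2) * J n x
    & J n.+1 x <=
        (1 + (4 * n.+1%:R + 2) * x + x ^+ 2) /
        (1 + (4 * n.+1%:R + 4) * x + x ^+ 2) * J n x].
Proof.
move=> x01; have [x0 x1] := andP x01.
have c0 : 0 <= (1 - x) / (1 + x) by rewrite divr_ge0; lra.
have [cvx h1 h2] := U_bounds n x0.
rewrite !J_U//; split.
- by rewrite mulrCA -mulrDr ler_wpM2l.
- by rewrite mulrCA ler_wpM2l.
- by rewrite mulrCA ler_wpM2l.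
Qed.

(** * Reduction of G to J *)

(** With z = x / (1 + x) one has 1 - z = 1 / (1 + x). *)
Lemma G_J (R : realType) (n : nat) (x : R) : 0 <= x ->
  G n.+1 x = J n (x / (1 + x)).
Proof.
move=> x0; have z0 : 1 + x != 0 by apply: lt0r_neq0; lra.
rewrite /G /J; congr (limn (series _)); apply/funext => k; congr (_ ^+ 2).
have -> : 1 - x / (1 + x) = (1 + x)^-1 by field.
rewrite addSn subn1 /= expr_div_n exprVn -!mulrA -invfM -exprD addnS.
by rewrite [(k + n)%N]addnC.
Qed.

Lemma G_bounds (R : realType) (n : nat) (x : R) : 0 <= x ->
  [/\ 2 * G n.+2 x <= G n.+1 x + G n.+3 x,
      G n.+3 x <=
        (1 + (4 * n.+2%:R - 2) * x * (1 + x)) /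
        (1 + (4 * n.+2%:R + 2) * x * (1 + x)) * G n.+1 x
    & G n.+2 x <=
        (1 + 4 * n.+2%:R * x * (x + 1)) /
        (1 + (4 * n.+2%:R + 2) * x * (x + 1)) * G n.+1 x].
Proof.
move=> x0; have z0 : 0 < 1 + x by lra.
have x01 : 0 <= x / (1 + x) < 1.
  by rewrite divr_ge0 ?(ltW z0)//= ltr_pdivrMr//; lra.
(* Since 1 + z^2 = (1 + 2 x (1 + x)) / (1 + x)^2 and z = x (1 + x) / (1 + x)^2
   for z = x / (1 + x), every coefficient is increased by 2. *)
have ratioE (a b : R) : 0 <= b ->
  (1 + a * (x / (1 + x)) + (x / (1 + x)) ^+ 2) /
  (1 + b * (x / (1 + x)) + (x / (1 + x)) ^+ 2) =
  (1 + (a + 2) * x * (1 + x)) / (1 + (b + 2) * x * (1 + x)).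
  move=> b0; have bx0 : 0 <= b * (x * (1 + x)) by rewrite !mulr_ge0//; lra.
  have x20 : 0 <= x ^+ 2 by rewrite sqr_ge0.
  by field; rewrite ?lt0r_neq0//; lra.
have n0 : 0 <= n.+1%:R :> R by [].
have [cvx] := J_bounds n x01; rewrite !ratioE; try lra.
move=> second first; rewrite !G_J// [x + 1]addrC -[n.+2%:R]natr1.
have -> : 4 * (n.+1%:R + 1) + 2 = 4 * n.+1%:R + 4 + 2 :> R by ring.
have -> : 4 * (n.+1%:R + 1) - 2 = 4 * n.+1%:R + 2 :> R by ring.
have -> : 4 * (n.+1%:R + 1) = 4 * n.+1%:R + 2 + 2 :> R by ring.
by split.
Qed.

Theorem theorem5 (R : realType) :
  [/\ forall (n : nat) (x : R), (1 <= n)%N -> 0 <= x ->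
        [/\ 2 * U n x <= U (n - 1)%N x + U (n + 1)%N x,
            U (n + 1)%N x <=
              (1 + 4 * n%:R * x + x ^+ 2) /
              (1 + (4 * n%:R + 4) * x + x ^+ 2) * U (n - 1)%N x
          & U n x <=
              (1 + (4 * n%:R + 2) * x + x ^+ 2) /
              (1 + (4 * n%:R + 4) * x + x ^+ 2) * U (n - 1)%N x],
      forall (n : nat) (x : R), (2 <= n)%N -> 0 <= x ->
        [/\ 2 * G n x <= G (n - 1)%N x + G (n + 1)%N x,
            G (n + 1)%N x <=
              (1 + (4 * n%:R - 2) * x * (1 + x)) /
              (1 + (4 * n%:R + 2) * x * (1 + x)) * G (n - 1)%N x
          & G n x <=
              (1 + 4 * n%:R * x * (x + 1)) /
              (1 + (4 * n%:R + 2) * x * (x + 1)) * G (n - 1)%N x]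
    & forall (n : nat) (x : R), (1 <= n)%N -> 0 <= x < 1 ->
        [/\ 2 * J n x <= J (n - 1)%N x + J (n + 1)%N x,
            J (n + 1)%N x <=
              (1 + 4 * n%:R * x + x ^+ 2) /
              (1 + (4 * n%:R + 4) * x + x ^+ 2) * J (n - 1)%N x
          & J n x <=
              (1 + (4 * n%:R + 2) * x + x ^+ 2) /
              (1 + (4 * n%:R + 4) * x + x ^+ 2) * J (n - 1)%N x]].
Proof.
split=> [[//|n] x _|[|[|n]]// x _|[//|n] x _]; rewrite subn1 addn1.
- exact: U_bounds.
- exact: G_bounds.
- exact: J_bounds.
Qed.
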